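(* The orthomodular lattices form a subvariety of the variety of quantum-Wajsberg algebras. This subvariety satisfies the condition $x=x^*\to x$, or equivalently, $x^*\Cup x=1$, or equivalently, $x^*\Cap x=0$.
   Context: A BE algebra is an algebra $(X,\to,1)$ of type $(2,0)$ such that for all $x,y,z\in X$: $x\to x=1$; $x\to 1=1$; $1\to x=x$; $x\to(y\to z)=y\to(x\to z)$. It is bounded if there is $0\in X$ with $0\to x=1$ for all $x\in X$; then $x^*:=x\to 0$. A bounded BE algebra is involutive if $x^{**}=x$ for all $x\in X$; it is written $(X,\to,{}^*,1)$ or $(X,\to,0,1)$, with $0=1^*$. In an involutive BE algebra put $x\Cup y=(x\to y)\to y$ and $x\Cap y=((x^*\to y^* )\to y^* )^*$. A quantum-Wajsberg algebra is an involutive BE algebra $(X,\to,{}^*,1)$ satisfying, for all $x,y,z\in X$, $x\to((x\Cap y)\Cap(z\Cap x))=(x\to y)\Cap(x\to z)$. An orthomodular lattice is an algebra $(L,\wedge,\vee,{}',0,1)$ such that $(L,\wedge,\vee,0,1)$ is a bounded lattice and for all $x,y\in L$: $x\wedge x'=0$ and $x\vee x'=1$; $(x\wedge y)'=x'\vee y'$ and $(x\vee y)'=x'\wedge y'$; $(x')'=x$; and $x\le y$ implies $x\vee(x'\wedge y)=y$ (where $x\le y$ iff $x=x\wedge y$). An orthomodular lattice $(X,\wedge,\vee,{}',0,1)$ is regarded as a quantum-Wajsberg algebra $(X,\to,0,1)$ via $x\to y=x'\vee y$, so that $x^*=x'$ and $x\vee y=x^*\to y$. The conditions on $x$ are required for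 all elements $x$ of the algebra. *)

(* Defs.v *)
From mathcomp Require Import all_boot.

Set Implicit Arguments.
Unset Strict Implicit.
Unset Printing Implicit Defensive.

Declare Scope qw_scope.
Delimit Scope qw_scope with qw.

(** Type (2,0,0): [zero] is part of the signature, so that boundedness is
    equational and [star] is a derived operation. *)
Record algebra : Type := Algebra {
  carrier :> Type;
  imp : carrier -> carrier -> carrier;
  zero : carrier;
  one : carrier }.

Arguments imp {_} _ _.
Arguments zero {_}.
Arguments one {_}.

Notation "x ~> y" := (imp x y) (at level 55, right associativity) : qw_scope.
Notation "0" := zero : qw_scope.
Notation "1" := one : qw_scope.

Local Open Scope qw_scope.

Definition star (A : algebra) (x : A) : A := x ~> 0.

Notation "x ^*" := (star x) : qw_scope.

Definition cup (A : algebra) (x y : A) : A := (x ~> y) ~> y.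
Definition cap (A : algebra) (x y : A) : A := ((x^* ~> y^*) ~> y^*)^*.

Inductive term : Type :=
| TVar of nat
| TImp of term & term
| TZero
| TOne.

Fixpoint eval (A : algebra) (v : nat -> A) (t : term) : A :=
  match t with
  | TVar n => v n
  | TImp s u => eval v s ~> eval v u
  | TZero => 0
  | TOne => 1
  end.

Definition satisfies (A : algebra) (s t : term) : Prop :=
  forall v : nat -> A, eval v s = eval v t.

(** A variety is an equational class in the language (~>, 0, 1). *)
Definition variety (K : algebra -> Prop) : Prop :=
  exists E : term -> term -> Prop,
    forall A : algebra, K A <-> (forall s t, E s t -> satisfies A s t).

Definition subvariety (K V : algebra -> Prop) : Prop :=
  [/\ variety K, variety V & forall A : algebra, K A -> V A].

Record be_algebra (A : algebra) : Prop := BEAlgebra {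
  be_refl : forall x : A, x ~> x = 1;
  be_top : forall x : A, x ~> 1 = 1;
  be_unit : forall x : A, 1 ~> x = x;
  be_exchange : forall x y z : A, x ~> (y ~> z) = y ~> (x ~> z) }.

Record bounded_be_algebra (A : algebra) : Prop := BoundedBEAlgebra {
  bounded_be :> be_algebra A;
  be_bot : forall x : A, 0 ~> x = 1 }.

Record involutive_be_algebra (A : algebra) : Prop := InvolutiveBEAlgebra {
  involutive_bounded :> bounded_be_algebra A;
  be_involutive : forall x : A, x^*^* = x }.

Record quantum_wajsberg (A : algebra) : Prop := QuantumWajsberg {
  qw_involutive :> involutive_be_algebra A;
  qw_axiom : forall x y z : A,
    x ~> cap (cap x y) (cap z x) = cap (x ~> y) (x ~> z) }.

Record bounded_lattice (L : Type) (meet join : L -> L -> L) (bot top : L)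
  : Prop := BoundedLattice {
  lat_meetC : commutative meet;
  lat_joinC : commutative join;
  lat_meetA : associative meet;
  lat_joinA : associative join;
  lat_joinK : forall x y, meet x (join x y) = x;
  lat_meetK : forall x y, join x (meet x y) = x;
  lat_bot : forall x, meet bot x = bot;
  lat_top : forall x, meet x top = x }.

Record orthomodular_lattice (L : Type) (meet join : L -> L -> L)
  (compl : L -> L) (bot top : L) : Prop := OrthomodularLattice {
  oml_lattice :> bounded_lattice meet join bot top;
  oml_meet_compl : forall x, meet x (compl x) = bot;
  oml_join_compl : forall x, join x (compl x) = top;
  oml_compl_meet : forall x y, compl (meet x y) = join (compl x) (compl y);
  oml_compl_join : forall x y, compl (join x y) = meet (compl x) (compl y);
  oml_complK : forall x, compl (compl x) = x;
  oml_orthomodular : forall x y,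
    x = meet x y -> join x (meet (compl x) y) = y }.

(** The algebras (L, ~>, 0, 1) obtained from the orthomodular lattices
    (L, meet, join, compl, 0, 1) by x ~> y = x' \/ y. *)
Definition orthomodular (A : algebra) : Prop :=
  exists (meet join : A -> A -> A) (compl : A -> A),
    orthomodular_lattice meet join compl 0 1 /\
    (forall x y : A, x ~> y = join (compl x) y).

(* Main.v *)
Require Import Defs.
From mathcomp Require Import all_boot.

(** Write x' for x ~> 0, x + y = x' ~> y and x . y = (x ~> y')'. In a
    quantum-Wajsberg algebra + is associative and commutative with De Morgan dual ., and
    cap x y = y . (y ~> x). The axiom at y = 0 gives cap x (x + z) = x; this
    weak absorption law turns (x + x) ~> x = 1 into x + x = x, and, once + is
    idempotent, yields both absorption and the orthomodular law for (., +).
    Conversely, in an orthomodular lattice cap x y is the Sasaki projection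
    y /\ (y' \/ x), and both sides of the axiom reduce to
    b /\ (b' \/ x' \/ y) with b = x' \/ z. *)

Set Implicit Arguments.
Unset Strict Implicit.

Local Open Scope qw_scope.

(** * Orthomodular lattices: Sasaki projections and the quantum-Wajsberg identity *)

Section OrthomodularToWajsberg.

Variables (L : Type) (meet join : L -> L -> L) (compl : L -> L) (bot top : L).
Hypothesis HL : orthomodular_lattice meet join compl bot top.

Local Notation "x /\' y" := (meet x y) (at level 40, left associativity).
Local Notation "x \/' y" := (join x y) (at level 50, left associativity).

Let meetC : commutative meet := lat_meetC HL.
Let joinC : commutative join := lat_joinC HL.
Let meetA : associative meet := lat_meetA HL.
Let joinA : associative join := lat_joinA HL.
Let joinK x y : x /\' (x \/' y) = x := lat_joinK HL x y.
Let meetK x y : x \/' (x /\' y) = x := lat_meetK HL x y.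
Let complK x : compl (compl x) = x := oml_complK HL x.
Let complM x y : compl (x /\' y) = compl x \/' compl y := oml_compl_meet HL x y.

Lemma oml_join_idem x : x \/' x = x.
Proof. by rewrite -{2}[x](joinK x x) meetK. Qed.

Lemma oml_meet_idem x : x /\' x = x.
Proof. by rewrite -{2}(meetK x x) joinK. Qed.

Lemma oml_join_top x : x \/' top = top.
Proof. by rewrite joinC -{2}(meetK top x) meetC (lat_top HL). Qed.

Lemma oml_join_bot x : x \/' bot = x.
Proof. by rewrite -(lat_bot HL x) meetC meetK. Qed.

Lemma oml_compl_bot : compl bot = top.
Proof. by rewrite -(oml_join_compl HL bot) joinC oml_join_bot. Qed.

Lemma oml_compl_top : compl top = bot.
Proof. by rewrite -oml_compl_bot complK. Qed.

(** Orthomodularity for y /\ x <= y splits y into y /\ x and y /\ (y' \/ x'); joining with x absorbs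
    the first piece. *)
Lemma oml_join_sasaki x y : x \/' (y /\' (compl y \/' compl x)) = x \/' y.
Proof.
have /(oml_orthomodular HL) e : y /\' x = y /\' x /\' y.
  by rewrite (meetC _ y) meetA oml_meet_idem.
by rewrite -[y in RHS]e complM [in RHS](meetC _ y) joinA (meetC y x) meetK.
Qed.

(** The modular law for x <= c, valid here because q is the complement of x relative to x \/ q:
    orthomodularity for x <= (x \/ q) /\ c leaves x' /\ (x \/ q) /\ c, that is q /\ c. *)
Lemma oml_modular_below x q c :
  q = compl x /\' (x \/' q) -> c = x \/' c -> x \/' (q /\' c) = (x \/' q) /\' c.
Proof.
move=> hq hc.
have /(oml_orthomodular HL) <- : x = x /\' ((x \/' q) /\' c).
  by rewrite meetA joinK hc joinK.
by rewrite (meetA (compl x)) -hq.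
Qed.

Lemma oml_sasaki_axiom x y z (x' := compl x)
    (sasaki := fun u v => v /\' (compl v \/' u)) :
  x' \/' sasaki (sasaki x y) (sasaki z x) = sasaki (x' \/' y) (x' \/' z).
Proof.
rewrite /sasaki -/x'; set b := x' \/' z; set p := y /\' _.
set q := x /\' b.
(* Orthomodularity for x' <= b; it makes q the complement of x' relative to b. *)
have xb : x' \/' q = b.
  by have /(oml_orthomodular HL) : x' = x' /\' b; rewrite /x' ?joinK // complK.
have cq : compl q = x' \/' compl b by rewrite complM.
rewrite oml_modular_below; last first.
- by rewrite cq !joinA oml_join_idem.
- by rewrite xb /x' complK.
rewrite xb cq; congr (_ /\' _).
(* Next to x', the projection p may be replaced by y. *)
by rewrite (joinC x') -!joinA -(oml_join_sasaki x' y) /x' complK.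
Qed.

End OrthomodularToWajsberg.

Section OrthomodularAlgebra.

Variables (A : algebra) (meet join : A -> A -> A) (compl : A -> A).
Hypothesis HL : orthomodular_lattice meet join compl 0 1.
Hypothesis impE : forall x y : A, x ~> y = join (compl x) y.

Lemma oml_starE (x : A) : x^* = compl x.
Proof. by rewrite /star impE (oml_join_bot HL). Qed.

Lemma oml_capE (x y : A) : cap x y = meet y (join (compl y) x).
Proof.
rewrite /cap !oml_starE !impE (oml_compl_join HL) !(oml_complK HL).
by rewrite (lat_meetC HL) (lat_joinC HL).
Qed.

Lemma oml_quantum_wajsberg : quantum_wajsberg A.
Proof.
split; [split; [split; [split|]|]|].
- by move=> x; rewrite impE (lat_joinC HL) (oml_join_compl HL).
- by move=> x; rewrite impE (oml_join_top HL).
- move=> x; rewrite impE (oml_compl_top HL) (lat_joinC HL).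
  exact: (oml_join_bot HL).
- move=> x y z; rewrite !impE !(lat_joinA HL).
  by rewrite (lat_joinC HL (compl x)).
- move=> x; rewrite impE (oml_compl_bot HL) (lat_joinC HL).
  exact: (oml_join_top HL).
- by move=> x; rewrite !oml_starE (oml_complK HL).
- move=> x y z; rewrite !oml_capE !impE.
  exact: (oml_sasaki_axiom HL).
Qed.

Lemma oml_imp_idem (x : A) : x = x^* ~> x.
Proof.
by rewrite oml_starE impE (oml_complK HL) (oml_join_idem HL).
Qed.

End OrthomodularAlgebra.

(** * Arithmetic of quantum-Wajsberg algebras *)

Section QuantumWajsberg.

Variable A : algebra.
Hypothesis HA : quantum_wajsberg A.
Implicit Types x y z : A.

Definition oplus x y : A := x^* ~> y.
Definition odot x y : A := (x ~> y^*)^*.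

Let starK x : x^*^* = x := be_involutive HA x.

Lemma star0 : 0^* = 1 :> A.
Proof. exact: (be_refl HA). Qed.

Lemma star1 : 1^* = 0 :> A.
Proof. exact: (be_unit HA). Qed.

Lemma imp_contra x y : x ~> y = y^* ~> x^*.
Proof. by rewrite /star (be_exchange HA) -!/(star _) starK. Qed.

Lemma oplusC : commutative oplus.
Proof. by move=> x y; rewrite /oplus imp_contra starK. Qed.

Lemma oplusA : associative oplus.
Proof.
by move=> x y z; rewrite (oplusC y) [RHS]oplusC /oplus (be_exchange HA).
Qed.

Lemma star_oplus x y : (oplus x y)^* = odot x^* y^*.
Proof. by rewrite /oplus /odot starK. Qed.

Lemma star_odot x y : (odot x y)^* = oplus x^* y^*.
Proof. by rewrite /oplus /odot !starK. Qed.

Lemma odotC : commutative odot.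
Proof. by move=> x y; rewrite /odot imp_contra starK. Qed.

Lemma odotA : associative odot.
Proof.
by move=> x y z; rewrite -[LHS]starK -[RHS]starK !star_odot oplusA.
Qed.

Lemma oplus_star x : oplus x x^* = 1.
Proof. exact: (be_refl HA). Qed.

Lemma odot_star x : odot x x^* = 0.
Proof. by rewrite /odot starK (be_refl HA) star1. Qed.

Lemma odot1 x : odot x 1 = x.
Proof. by rewrite /odot star1 starK. Qed.

Lemma odot0 x : odot x 0 = 0.
Proof. by rewrite /odot star0 (be_top HA) star1. Qed.

Lemma capE x y : cap x y = odot y (y ~> x).
Proof. by rewrite odotC /odot /cap -imp_contra. Qed.

Lemma cap_oplus x z : cap x (oplus x z) = x.
Proof.
(* At [x^*] the right side becomes [cap x (oplus x z)]; on the left both outer caps collapse to [0],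
   leaving [x^* ~> 0], which is x. *)
have := qw_axiom HA x^* 0 z; rewrite -/(star _) starK -/(oplus x z) => <-.
have -> : cap x^* 0 = 0 by rewrite capE odotC odot0.
by rewrite capE odot_star -/(star _) starK.
Qed.

Lemma cup_star_one_idem x : cup x^* x = 1 -> x = x^* ~> x.
Proof.
rewrite /cup => e; have := cap_oplus x x.
by rewrite capE {2}/oplus e odot1.
Qed.

Lemma idem_cup_star x : x = x^* ~> x -> cup x^* x = 1.
Proof. by rewrite /cup => <-; apply: (be_refl HA). Qed.

Lemma cap_starE x : cap x^* x = (cup x x^*)^*.
Proof. by rewrite /cap /cup starK. Qed.

(** The cap condition at x is the cup condition at [x^*], so the two match only once x ranges over
    the whole algebra. *)
Lemma cap_star_zero x : (cap x^* x = 0) <-> (cup x^*^* x^* = 1).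
Proof.
rewrite cap_starE starK; split => [e|->]; last exact: star1.
by rewrite -[LHS]starK e star0.
Qed.

(** * The orthomodular lattice of an idempotent quantum-Wajsberg algebra *)

Section Idempotent.

Hypothesis idem : forall x, x = x^* ~> x.

Lemma odotK x y : odot x (oplus x y) = x.
Proof.
have odotxx w : odot w w = w.
  by rewrite -[LHS]starK star_odot /oplus -idem starK.
have := cap_oplus x y; rewrite capE => e.
(* Weak absorption exhibits x as a multiple of [oplus x y], which is idempotent for [odot]. *)
by rewrite -[x in odot x _]e odotC odotA odotxx.
Qed.

Lemma oplusK x y : oplus x (odot x y) = x.
Proof. by rewrite -[LHS]starK star_oplus (star_odot x y) odotK starK. Qed.

(** This is the De Morgan dual of weak absorption at [y^*] and [x^*], whose sum is [x^*] by
    hypothesis. *)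
Lemma idem_orthomodular x y : x = odot x y -> oplus x (odot x^* y) = y.
Proof.
move=> e.
have e' : x^* = oplus y^* x^* by rewrite [in LHS]e star_odot oplusC.
have := cap_oplus y^* x^*; rewrite -e' capE => /(congr1 (@star A)).
by rewrite star_odot !starK.
Qed.

Lemma idem_oml : orthomodular A.
Proof.
exists odot, oplus, (@star A); split; last by move=> x y; rewrite /oplus starK.
split; first split.
- exact: odotC.
- exact: oplusC.
- exact: odotA.
- exact: oplusA.
- exact: odotK.
- exact: oplusK.
- by move=> x; rewrite odotC odot0.
- exact: odot1.
- exact: odot_star.
- exact: oplus_star.
- exact: star_odot.
- exact: star_oplus.
- exact: starK.
- exact: idem_orthomodular.
Qed.

End Idempotent.

End QuantumWajsberg.

Lemma orthomodularP (A : algebra) :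
  orthomodular A <-> quantum_wajsberg A /\ (forall x : A, x = x^* ~> x).
Proof.
split=> [[meet [join [compl [HL impE]]]]|[HA idem]]; last exact: idem_oml.
by split; [apply: oml_quantum_wajsberg HL impE | apply: oml_imp_idem HL impE].
Qed.

(** * Equational classes *)

(** The defining identities are taken to be the whole equational theory of [K], so only closure has
    to be checked. *)
Lemma variety_of_theory (K : algebra -> Prop) :
  (forall A, (forall s t, (forall B, K B -> satisfies B s t) ->
     satisfies A s t) -> K A) -> variety K.
Proof.
move=> closedK; exists (fun s t => forall B, K B -> satisfies B s t) => A.
by split=> [KA s t|]; [apply | apply: closedK].
Qed.

Definition tstar (s : term) : term := TImp s TZero.
Definition tcap (s t : term) : term :=
  tstar (TImp (TImp (tstar s) (tstar t)) (tstar t)).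

(** Stated for any class of quantum-Wajsberg algebras, so that it serves both varieties. *)
Lemma quantum_wajsberg_theory (K : algebra -> Prop) (A : algebra) :
  (forall B, K B -> quantum_wajsberg B) ->
  (forall s t, (forall B, K B -> satisfies B s t) -> satisfies A s t) ->
  quantum_wajsberg A.
Proof.
move=> KQ law.
pose X := TVar 0; pose Y := TVar 1; pose Z := TVar 2.
(* Variable 2 takes the value z as the default of [nth]. *)
pose val (x y z : A) n := nth z [:: x; y] n.
split; [split; [split; [split|]|]|].
- move=> x; apply: (law (TImp X X) TOne _ (val x x x)) => B /KQ QB v.
  exact: (be_refl QB).
- move=> x; apply: (law (TImp X TOne) TOne _ (val x x x)) => B /KQ QB v.
  exact: (be_top QB).
- move=> x; apply: (law (TImp TOne X) X _ (val x x x)) => B /KQ QB v.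
  exact: (be_unit QB).
- move=> x y z.
  apply: (law (TImp X (TImp Y Z)) (TImp Y (TImp X Z)) _ (val x y z)).
  by move=> B /KQ QB v; apply: (be_exchange QB).
- move=> x; apply: (law (TImp TZero X) TOne _ (val x x x)) => B /KQ QB v.
  exact: (be_bot QB).
- move=> x; apply: (law (tstar (tstar X)) X _ (val x x x)) => B /KQ QB v.
  exact: (be_involutive QB).
- move=> x y z.
  apply: (law (TImp X (tcap (tcap X Y) (tcap Z X)))
              (tcap (TImp X Y) (TImp X Z)) _ (val x y z)).
  by move=> B /KQ QB v; apply: (qw_axiom QB).
Qed.

Theorem corollary5p12 :
  subvariety orthomodular quantum_wajsberg /\
  (forall A : algebra,
     orthomodular A <-> quantum_wajsberg A /\ (forall x : A, x = x^* ~> x)) /\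
  (forall A : algebra, quantum_wajsberg A ->
     ((forall x : A, x = x^* ~> x) <-> (forall x : A, cup (x^*) x = 1)) /\
     ((forall x : A, x = x^* ~> x) <-> (forall x : A, cap (x^*) x = 0))).
Proof.
have omlQ (B : algebra) : orthomodular B -> quantum_wajsberg B.
  by case/orthomodularP.
split; [split=> // | split; first exact: orthomodularP].
- apply: variety_of_theory => A law; apply/orthomodularP; split.
    exact: quantum_wajsberg_theory omlQ law.
  move=> x; pose X := TVar 0.
  apply: (law X (TImp (tstar X) X) _ (fun=> x)) => B /orthomodularP[_ idem] v.
  exact: idem.
- by apply: variety_of_theory => A; apply: quantum_wajsberg_theory.
- move=> A HA; have idemP : (forall x : A, x = x^* ~> x) <->
      (forall x : A, cup (x^*) x = 1).
    split=> h x; first exact: idem_cup_star.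
    exact: cup_star_one_idem.
  split=> //; split=> [/idemP h x|h]; first exact/cap_star_zero.
  (* Writing x as [x^*^*] turns the cup condition at x into the cap condition at [x^*]. *)
  by apply/idemP => x; rewrite -(be_involutive HA x); apply/cap_star_zero.
Qed.
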